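(* For every integer $d\ge2$: (1) $\mathcal{VC}_{V_d}(V_{[0,1/d)})=\mathcal C_{V_d}(V_{[0,1/d)})=V_{[1/d,1]}$; (2) $\mathcal{VC}_{V_d}(V_{[1/d,1]})=\mathcal C_{V_d}(V_{[1/d,1]})=V_{[0,1/d)}$; (3) $\mathcal{VC}_{T_d}(T_{[0,1/d)})=\mathcal C_{T_d}(T_{[0,1/d)})=T_{[1/d,1]}$; (4) $\mathcal{VC}_{T_d}(T_{[1/d,1]})=\mathcal C_{T_d}(T_{[1/d,1]})=T_{[0,1/d)}$. In particular $(L(V_{[0,1/d)})'\cap L(V_d))'\cap L(V_d)=L(V_{[0,1/d)})$ and $(L(T_{[0,1/d)})'\cap L(T_d))'\cap L(T_d)=L(T_{[0,1/d)})$.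
   Context: $V_d$ is the Higman–Thompson group of piecewise affine bijections of $[0,1)$ with finitely many $d$-adic breakpoints and slopes powers of $d$; $T_d$ its subgroup of elements inducing circle homeomorphisms. $V_{[0,1/d)}$ (resp. $V_{[1/d,1]}$) is the subgroup of $V_d$ of elements acting as the identity on $[0,1/d)$ (resp. on $[1/d,1)$); $T_{[0,1/d)}$, $T_{[1/d,1]}$ are defined likewise in $T_d$. For $H\le G$: $\mathcal C_G(H)=\{g\in G:h^{-1}gh=g\ \forall h\in H\}$ and the virtual centralizer $\mathcal{VC}_G(H)=\{g\in G:\{h^{-1}gh:h\in H\}\text{ is finite}\}$. For $A\subseteq L(G)$, $A'\cap L(G)$ is the relative commutant. *)

(* Defs.v *)
From Stdlib Require Import Reals ZArith List ClassicalEpsilon.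
Open Scope R_scope.

Definition dadic (d : nat) (x : R) : Prop :=
  exists (z : Z) (n : nat), x = IZR z / (INR d ^ n).

Definition inI (x : R) : Prop := 0 <= x < 1.

(* Elements of V_d are represented as functions R -> R that are the identity
   outside [0,1); on [0,1) they are piecewise affine bijections with finitely
   many d-adic breakpoints a_0 = 0 < a_1 < ... < a_n = 1, slopes integer
   powers of d, and mapping d-adic points to d-adic points (d-adic intercepts). *)
Definition Vd (d : nat) (f : R -> R) : Prop :=
  (forall x, ~ inI x -> f x = x) /\
  (forall x, inI x -> inI (f x)) /\
  (forall y, inI y -> exists x, inI x /\ f x = y) /\
  (forall x y, inI x -> inI y -> f x = f y -> x = y) /\
  exists (n : nat) (a : nat -> R),
    a 0%nat = 0 /\ a n = 1 /\
    (forall i, (i < n)%nat -> a i < a (S i) /\ dadic d (a i)) /\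
    (forall i, (i < n)%nat -> exists (k : Z) (b : R), dadic d b /\
        forall x, a i <= x < a (S i) -> f x = powerRZ (INR d) k * x + b).

Definition cdist (x y : R) : R := Rmin (Rabs (x - y)) (1 - Rabs (x - y)).

Definition circle_continuous (f : R -> R) : Prop :=
  forall x, inI x -> forall eps, 0 < eps -> exists delta, 0 < delta /\
    forall y, inI y -> cdist x y < delta -> cdist (f x) (f y) < eps.

Definition induces_circle_homeo (f : R -> R) : Prop :=
  (forall x, inI x -> inI (f x)) /\ circle_continuous f /\
  exists g : R -> R, (forall y, inI y -> inI (g y)) /\
    (forall x, inI x -> g (f x) = x) /\ (forall y, inI y -> f (g y) = y) /\
    circle_continuous g.

Definition Td (d : nat) (f : R -> R) : Prop := Vd d f /\ induces_circle_homeo f.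

Definition fix_left (d : nat) (f : R -> R) : Prop :=
  forall x, 0 <= x < 1 / INR d -> f x = x.
Definition fix_right (d : nat) (f : R -> R) : Prop :=
  forall x, 1 / INR d <= x < 1 -> f x = x.

Definition V_left  (d : nat) f := Vd d f /\ fix_left d f.   (* V_{[0,1/d)} *)
Definition V_right (d : nat) f := Vd d f /\ fix_right d f.  (* V_{[1/d,1]} *)
Definition T_left  (d : nat) f := Td d f /\ fix_left d f.   (* T_{[0,1/d)} *)
Definition T_right (d : nat) f := Td d f /\ fix_right d f.  (* T_{[1/d,1]} *)

(* inverse function (elements of V_d are bijections of R) *)
Definition finv (h : R -> R) (y : R) : R :=
  epsilon (inhabits 0) (fun x => h x = y).

Definition conj (h g : R -> R) : R -> R := fun x => finv h (g (h x)).

Definition finite_set {T : Type} (P : T -> Prop) : Prop :=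
  exists l : list T, forall t, P t -> In t l.

Definition centralizer (G H : (R -> R) -> Prop) (g : R -> R) : Prop :=
  G g /\ forall h, H h -> conj h g = g.

Definition vcentralizer (G H : (R -> R) -> Prop) (g : R -> R) : Prop :=
  G g /\ finite_set (fun k => exists h, H h /\ k = conj h g).

Definition same_set (A B : (R -> R) -> Prop) : Prop := forall g, A g <-> B g.

(* Main.v *)
Require Import Defs.
From Stdlib Require Import Reals Lra Lia List.
From Stdlib Require Import Classical ClassicalEpsilon FunctionalExtensionality FinFun.
Open Scope R_scope.

(* A subgroup H of V_d supported on an interval (p,q) contains, for every d-adic window
   [u,w] inside (p,q) and every a = d^-n small enough, a map that translates the middle of
   [u,w] by a - a/d.  If g x <> x for some x in (p,q), pick the window around exactly one of
   x, g x: evaluating the conjugates of g by these maps at x (or at the preimage of x) shows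
   that they are pairwise distinct, so g has infinitely many H-conjugates.  Hence a virtual
   centralizer of H fixes (p,q), and by right-continuity [p,q); conversely, maps with
   complementary supports commute.  The theorem is the case of the cut point 1/d, in V_d
   and in T_d, where these translation maps are also circle homeomorphisms. *)

Lemma INR_ge_2 d : (2 <= d)%nat -> 2 <= INR d.
Proof. intros hd. apply le_INR in hd. simpl in hd. lra. Qed.

Lemma pow_INR_pos d n : (2 <= d)%nat -> 0 < INR d ^ n.
Proof. intros hd. apply pow_lt. pose proof (INR_ge_2 d hd). lra. Qed.

Lemma dadic_0 d : dadic d 0.
Proof. exists 0%Z, 0%nat. simpl. field. Qed.

Lemma dadic_inv_pow d n : dadic d (/ INR d ^ n).
Proof. exists 1%Z, n. unfold Rdiv. ring. Qed.

Lemma dadic_add d x y : (2 <= d)%nat -> dadic d x -> dadic d y -> dadic d (x + y).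
Proof.
  intros hd [z1 [n1 ->]] [z2 [n2 ->]].
  exists (z1 * Z.of_nat d ^ Z.of_nat n2 + z2 * Z.of_nat d ^ Z.of_nat n1)%Z, (n1 + n2)%nat.
  rewrite plus_IZR, !mult_IZR, <- !pow_IZR, <- !INR_IZR_INZ, pow_add.
  pose proof (pow_INR_pos d n1 hd). pose proof (pow_INR_pos d n2 hd).
  field. lra.
Qed.

Lemma dadic_opp d x : dadic d x -> dadic d (- x).
Proof. intros [z [n ->]]. exists (- z)%Z, n. rewrite opp_IZR. unfold Rdiv. ring. Qed.

Lemma dadic_sub d x y : (2 <= d)%nat -> dadic d x -> dadic d y -> dadic d (x - y).
Proof. intros hd hx hy. apply dadic_add, dadic_opp; assumption. Qed.

Lemma dadic_div d x : (2 <= d)%nat -> dadic d x -> dadic d (x / INR d).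
Proof.
  intros hd [z [n ->]]. exists z, (S n).
  pose proof (pow_INR_pos d n hd). pose proof (INR_ge_2 d hd).
  simpl. field. lra.
Qed.

Lemma dadic_mul d x : dadic d x -> dadic d (INR d * x).
Proof.
  intros [z [n ->]]. exists (Z.of_nat d * z)%Z, n.
  rewrite mult_IZR, <- INR_IZR_INZ. unfold Rdiv. ring.
Qed.

Lemma inv_pow_eventually_lt d eps : (2 <= d)%nat -> 0 < eps ->
  exists N, forall n, (N <= n)%nat -> / INR d ^ n < eps.
Proof.
  intros hd heps. pose proof (INR_ge_2 d hd).
  assert (hinv : 0 < / INR d < 1).
  { split; [apply Rinv_0_lt_compat; lra|].
    rewrite <- Rinv_1. apply Rinv_lt_contravar; lra. }
  destruct (pow_lt_1_zero (/ INR d)) with (y := eps) as [N HN].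
  { rewrite Rabs_right; lra. }
  { assumption. }
  exists N. intros n hn. specialize (HN n hn).
  rewrite Rabs_right, pow_inv in HN; [assumption|].
  left. apply pow_lt. lra.
Qed.

Lemma dadic_dense d a b : (2 <= d)%nat -> a < b -> exists c, dadic d c /\ a < c < b.
Proof.
  intros hd hab. destruct (inv_pow_eventually_lt d (b - a) hd) as [n hn]; [lra|].
  specialize (hn n (le_n n)). pose proof (pow_INR_pos d n hd).
  set (P := INR d ^ n) in *. destruct (archimed (a * P)) as [hup1 hup2].
  exists (IZR (up (a * P)) / P). split; [exists (up (a * P)), n; reflexivity|].
  assert (P * / P = 1) by (field; lra).
  assert (0 < / P) by (apply Rinv_0_lt_compat; lra).
  unfold Rdiv. set (U := IZR (up (a * P))) in *.
  assert (U * / P - a = (U - a * P) * / P) by (field; lra). split; nra.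
Qed.

Lemma dadic_small_injective_seq d eps : (2 <= d)%nat -> 0 < eps ->
  exists s : nat -> R, Injective s /\ forall n, dadic d (s n) /\ 0 < s n < eps.
Proof.
  intros hd heps. pose proof (INR_ge_2 d hd).
  destruct (inv_pow_eventually_lt d eps hd heps) as [N hN].
  exists (fun n => / INR d ^ (N + n)). split.
  - intros n m E. apply Rinv_eq_reg in E.
    destruct (Nat.lt_total n m) as [h|[h|h]]; [exfalso| |exfalso]; try assumption.
    + assert (INR d ^ (N + n) < INR d ^ (N + m)) by (apply Rlt_pow; [lra|lia]). lra.
    + assert (INR d ^ (N + m) < INR d ^ (N + n)) by (apply Rlt_pow; [lra|lia]). lra.
  - intros n. split; [apply dadic_inv_pow|]. split.
    + apply Rinv_0_lt_compat, pow_INR_pos, hd.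
    + apply hN. lia.
Qed.

(* Identity off [u,w); on [u,w) slopes 1/D, 1, D, so that the middle piece is translated
   left by a - a/D. *)
Definition push (D u w a x : R) : R :=
  if Rlt_dec x u then x
  else if Rlt_dec x (u + a) then u + (x - u) / D
  else if Rlt_dec x (w - a / D) then x - a + a / D
  else if Rlt_dec x w then w + D * (x - w)
  else x.

Definition push_inv (D u w a y : R) : R :=
  if Rlt_dec y u then y
  else if Rlt_dec y (u + a / D) then u + D * (y - u)
  else if Rlt_dec y (w - a) then y + a - a / D
  else if Rlt_dec y w then w + (y - w) / D
  else y.

Definition push_admissible (D u w a : R) : Prop := 2 <= D /\ 0 < a /\ a + a / D < w - u.

Section Push.

Variables D u w a : R.
Hypothesis adm : push_admissible D u w a.

Ltac push_cases :=
  destruct adm as (HD & Ha & Hwu);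
  unfold push, push_inv, inI, Rdiv in *;
  assert (D * / D = 1) by (field; lra);
  assert (0 < / D) by (apply Rinv_0_lt_compat; lra);
  assert (/ D <= 1 / 2) by (apply Rinv_le_contravar in HD; lra);
  set (e := / D) in *; clearbody e;
  repeat destruct Rlt_dec; try split; nra.

Lemma push_inv_push x : push_inv D u w a (push D u w a x) = x.
Proof. push_cases. Qed.

Lemma push_push_inv y : push D u w a (push_inv D u w a y) = y.
Proof. push_cases. Qed.

Lemma push_injective : Injective (push D u w a).
Proof. intros x y E. rewrite <- (push_inv_push x), E. apply push_inv_push. Qed.

Lemma push_inv_injective : Injective (push_inv D u w a).
Proof. intros x y E. rewrite <- (push_push_inv x), E. apply push_push_inv. Qed.

Lemma push_monotone_lipschitz x y : x <= y ->
  0 <= push D u w a y - push D u w a x <= D * (y - x).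
Proof. intros. push_cases. Qed.

Lemma push_inv_monotone_lipschitz x y : x <= y ->
  0 <= push_inv D u w a y - push_inv D u w a x <= D * (y - x).
Proof. intros. push_cases. Qed.

Lemma push_outside x : x < u \/ w <= x -> push D u w a x = x.
Proof. intros. push_cases. Qed.

Lemma push_inv_outside y : y < u \/ w <= y -> push_inv D u w a y = y.
Proof. intros. push_cases. Qed.

Lemma push_first_piece x : u <= x < u + a -> push D u w a x = / D * x + (u - u / D).
Proof. intros. push_cases. Qed.

Lemma push_middle x : u + a <= x < w - a / D -> push D u w a x = x - a + a / D.
Proof. intros. push_cases. Qed.

Lemma push_last_piece x : w - a / D <= x < w -> push D u w a x = D * x + (w - D * w).
Proof. intros. push_cases. Qed.

Lemma push_inv_middle y : u + a / D <= y < w - a -> push_inv D u w a y = y + a - a / D.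
Proof. intros. push_cases. Qed.

Lemma push_shift_bounds : 0 < a / D < a.
Proof. push_cases. Qed.

Lemma push_breakpoints_increasing : u < u + a < w - a / D /\ w - a / D < w.
Proof. push_cases. Qed.

Lemma push_inI x : 0 <= u -> w <= 1 -> inI x -> inI (push D u w a x).
Proof. intros. push_cases. Qed.

Lemma push_inv_inI y : 0 <= u -> w <= 1 -> inI y -> inI (push_inv D u w a y).
Proof. intros. push_cases. Qed.

End Push.

Lemma push_window D u w t : 2 <= D -> u < t < w ->
  exists eps, 0 < eps /\
    forall a, 0 < a < eps -> push_admissible D u w a /\ u + a < t < w - a.
Proof.
  intros HD ht.
  exists (Rmin ((w - u) / 2) (Rmin (t - u) (w - t))).
  pose proof (Rmin_l ((w - u) / 2) (Rmin (t - u) (w - t))).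
  pose proof (Rmin_r ((w - u) / 2) (Rmin (t - u) (w - t))).
  pose proof (Rmin_l (t - u) (w - t)). pose proof (Rmin_r (t - u) (w - t)).
  split; [repeat apply Rmin_pos; lra|].
  intros a ha.
  assert (a / D < a).
  { apply (Rmult_lt_reg_r D); [lra|]. unfold Rdiv. rewrite Rmult_assoc, Rinv_l by lra. nra. }
  assert (0 < a / D) by (apply Rdiv_lt_0_compat; lra).
  repeat split; lra.
Qed.

Lemma cdist_monotone_lipschitz (f : R -> R) K x y : 1 <= K -> f 0 = 0 -> f 1 = 1 ->
  (forall x y, x <= y -> 0 <= f y - f x <= K * (y - x)) ->
  inI x -> inI y -> cdist (f x) (f y) <= K * cdist x y.
Proof.
  intros HK f0 f1 Hf.
  assert (Hle : forall x y, inI x -> inI y -> x <= y -> cdist (f x) (f y) <= K * cdist x y).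
  { intros s t [hs0 hs1] [ht0 ht1] hst. unfold cdist.
    pose proof (Hf s t hst). pose proof (Hf 0 s hs0). pose proof (Hf t 1 (Rlt_le _ _ ht1)).
    rewrite (Rabs_left1 (f s - f t)), (Rabs_left1 (s - t)) by lra.
    unfold Rmin; repeat destruct Rle_dec; nra. }
  intros hx hy. destruct (Rle_dec x y); [now apply Hle|].
  unfold cdist. rewrite (Rabs_minus_sym (f x)), (Rabs_minus_sym x).
  apply Hle; auto; lra.
Qed.

Lemma circle_continuous_of_lipschitz (f : R -> R) K : 1 <= K -> f 0 = 0 -> f 1 = 1 ->
  (forall x y, x <= y -> 0 <= f y - f x <= K * (y - x)) -> circle_continuous f.
Proof.
  intros HK f0 f1 Hf x hx eps heps. exists (eps / K).
  split; [apply Rdiv_lt_0_compat; lra|].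
  intros y hy hxy. eapply Rle_lt_trans; [apply cdist_monotone_lipschitz; eauto|].
  apply (Rmult_lt_compat_l K) in hxy; [|lra].
  replace (K * (eps / K)) with eps in hxy by (field; lra). exact hxy.
Qed.

Definition push_breakpoint (D u w a : R) (i : nat) : R :=
  match i with
  | 0%nat => 0 | 1%nat => u | 2%nat => u + a | 3%nat => w - a / D | 4%nat => w | _ => 1
  end.

Lemma push_in_Vd d u w a : (2 <= d)%nat -> push_admissible (INR d) u w a ->
  0 < u -> w < 1 -> dadic d u -> dadic d w -> dadic d a -> Vd d (push (INR d) u w a).
Proof.
  intros hd adm hu hw du dw da.
  pose proof (push_breakpoints_increasing _ _ _ _ adm). pose proof (INR_ge_2 d hd).
  assert (dadic d (a / INR d)) by (apply dadic_div; assumption).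
  split; [|split; [|split; [|split]]].
  - intros x hx. apply push_outside; [assumption|]. unfold inI in hx. lra.
  - intros x hx. apply push_inI; auto; lra.
  - intros y hy. exists (push_inv (INR d) u w a y).
    split; [apply push_inv_inI; auto; lra|apply push_push_inv, adm].
  - intros x y _ _. apply push_injective, adm.
  - exists 5%nat, (push_breakpoint (INR d) u w a).
    split; [reflexivity|split; [reflexivity|split]].
    + intros i hi. destruct i as [|[|[|[|[|i]]]]]; try lia; simpl;
        (split; [lra|]); auto using dadic_0, dadic_add, dadic_sub.
    + intros i hi. destruct i as [|[|[|[|[|i]]]]]; try lia; simpl.
      * exists 0%Z, 0. split; [apply dadic_0|]. intros x hx.
        rewrite push_outside by (auto; lra). simpl. ring.
      * exists (-1)%Z, (u - u / INR d).
        split; [apply dadic_sub, dadic_div; assumption|].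
        intros x hx. rewrite push_first_piece by assumption. simpl. field. lra.
      * exists 0%Z, (a / INR d - a). split; [apply dadic_sub; assumption|].
        intros x hx. rewrite push_middle by assumption. simpl. ring.
      * exists 1%Z, (w - INR d * w). split; [apply dadic_sub, dadic_mul; assumption|].
        intros x hx. rewrite push_last_piece by assumption. simpl. ring.
      * exists 0%Z, 0. split; [apply dadic_0|]. intros x hx.
        rewrite push_outside by (auto; lra). simpl. ring.
Qed.

Lemma push_in_Td d u w a : (2 <= d)%nat -> push_admissible (INR d) u w a ->
  0 < u -> w < 1 -> dadic d u -> dadic d w -> dadic d a -> Td d (push (INR d) u w a).
Proof.
  intros hd adm hu hw du dw da. pose proof (INR_ge_2 d hd).
  split; [apply push_in_Vd; assumption|].
  split; [|split; [|exists (push_inv (INR d) u w a); split; [|split; [|split]]]].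
  - intros x hx. apply push_inI; auto; lra.
  - apply (circle_continuous_of_lipschitz _ (INR d)); [lra| | |].
    + apply push_outside; auto; lra.
    + apply push_outside; auto; lra.
    + intros. apply push_monotone_lipschitz; assumption.
  - intros y hy. apply push_inv_inI; auto; lra.
  - intros x _. apply push_inv_push, adm.
  - intros y _. apply push_push_inv, adm.
  - apply (circle_continuous_of_lipschitz _ (INR d)); [lra| | |].
    + apply push_inv_outside; auto; lra.
    + apply push_inv_outside; auto; lra.
    + intros. apply push_inv_monotone_lipschitz; assumption.
Qed.

Definition fixes_on (p q : R) (f : R -> R) : Prop := forall x, p <= x < q -> f x = x.

Definition contains_pushes (d : nat) (H : (R -> R) -> Prop) (p q : R) : Prop :=
  forall u w, dadic d u -> dadic d w -> p < u -> w < q ->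
  forall a, dadic d a -> push_admissible (INR d) u w a -> H (push (INR d) u w a).

Lemma contains_pushes_Vd d : (2 <= d)%nat -> contains_pushes d (Vd d) 0 1.
Proof. intros hd u w du dw hu hw a da adm. apply push_in_Vd; assumption. Qed.

Lemma contains_pushes_Td d : (2 <= d)%nat -> contains_pushes d (Td d) 0 1.
Proof. intros hd u w du dw hu hw a da adm. apply push_in_Td; assumption. Qed.

Lemma contains_pushes_fixing d G p q p' q' : contains_pushes d G 0 1 ->
  0 <= p -> q <= 1 -> q' <= p \/ q <= p' ->
  contains_pushes d (fun f => G f /\ fixes_on p' q' f) p q.
Proof.
  intros HG hp hq hsep u w du dw hu hw a da adm.
  split; [apply HG; auto; lra|].
  intros x hx. apply push_outside; [assumption|lra].
Qed.

Lemma Vd_injective d g : Vd d g -> Injective g.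
Proof.
  intros (Hout & Hin & _ & Hinj & _) x y E.
  destruct (classic (inI x)) as [hx|hx]; destruct (classic (inI y)) as [hy|hy].
  - apply Hinj; assumption.
  - rewrite (Hout y hy) in E. exfalso. apply hy. rewrite <- E. auto.
  - rewrite (Hout x hx) in E. exfalso. apply hx. rewrite E. auto.
  - rewrite (Hout x hx), (Hout y hy) in E. assumption.
Qed.

Lemma finv_injective h z : Injective h -> finv h (h z) = z.
Proof.
  intros Hh. apply Hh. unfold finv.
  apply (epsilon_spec (inhabits 0) (fun x => h x = h z)). exists z. reflexivity.
Qed.

Lemma conj_push D u w a g x : push_admissible D u w a ->
  conj (push D u w a) g x = push_inv D u w a (g (push D u w a x)).
Proof.
  intros adm. unfold conj.
  rewrite <- (push_push_inv _ _ _ _ adm (g (push D u w a x))) at 1.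
  apply finv_injective, push_injective, adm.
Qed.

Lemma conj_of_commute h g : Injective h -> (forall x, h (g x) = g (h x)) -> conj h g = g.
Proof.
  intros Hh Hc. apply functional_extensionality. intros x. unfold conj.
  rewrite <- Hc. apply finv_injective, Hh.
Qed.

Lemma commute_of_disjoint_supports (S : R -> Prop) g h : Injective g -> Injective h ->
  (forall x, ~ S x -> g x = x) -> (forall x, S x -> h x = x) ->
  forall x, h (g x) = g (h x).
Proof.
  intros Hg Hh Hgs Hhs x. destruct (classic (S x)) as [hx|hx].
  - assert (S (g x)).
    { apply NNPP. intros hgx. apply hgx. rewrite (Hg _ _ (Hgs _ hgx)). assumption. }
    rewrite (Hhs x hx). apply Hhs. assumption.
  - assert (~ S (h x)).
    { intros hhx. apply hx. rewrite <- (Hh _ _ (Hhs _ hhx)). assumption. }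
    rewrite (Hgs x hx). symmetry. apply Hgs. assumption.
Qed.

Lemma partition_index (a : nat -> R) n x : a 0%nat = 0 -> a n = 1 ->
  (forall i, (i < n)%nat -> a i < a (S i)) -> inI x ->
  exists i, (i < n)%nat /\ a i <= x < a (S i).
Proof.
  intros a0 an Ha [hx0 hx1].
  assert (Hm : forall m, (m <= n)%nat ->
    a m <= x \/ exists i, (i < m)%nat /\ a i <= x < a (S i)).
  { induction m as [|m IH]; intros hm; [left; lra|].
    destruct IH as [h|[i [hi hx]]]; [lia| |].
    - destruct (Rlt_dec x (a (S m))); [right; exists m; split; [lia|lra]|left; lra].
    - right. exists i. split; [lia|assumption]. }
  destruct (Hm n (le_n n)) as [h|h]; [lra|assumption].
Qed.

Lemma Vd_right_affine d g x : Vd d g -> inI x ->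
  exists eps s b, 0 < eps /\ forall z, x <= z < x + eps -> g z = s * z + b.
Proof.
  intros (_ & _ & _ & _ & n & a & a0 & an & Ha & Hg) hx.
  destruct (partition_index a n x a0 an) as [i [hi hxi]]; [intros i hi; apply Ha, hi|assumption|].
  destruct (Hg i hi) as [k [b [_ Hb]]].
  exists (a (S i) - x), (powerRZ (INR d) k), b. split; [lra|].
  intros z hz. apply Hb. lra.
Qed.

(* An affine germ on [p, p + eps) fixing two points of (p, q) is the identity. *)
Lemma fixes_on_of_interior d g p q : Vd d g -> 0 <= p < q -> q <= 1 ->
  (forall x, p < x < q -> g x = x) -> fixes_on p q g.
Proof.
  intros Hg hpq hq Hfix x hx. destruct (Req_dec x p) as [->|hne]; [|apply Hfix; lra].
  destruct (Vd_right_affine d g p Hg) as [eps [s [b [heps Hb]]]]; [unfold inI; lra|].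
  pose proof (Rmin_l eps (q - p)). pose proof (Rmin_r eps (q - p)).
  set (e := Rmin eps (q - p)) in *.
  assert (0 < e) by (apply Rmin_pos; lra).
  assert (s * (p + e / 2) + b = p + e / 2) by (rewrite <- Hb by lra; apply Hfix; lra).
  assert (s * (p + e / 4) + b = p + e / 4) by (rewrite <- Hb by lra; apply Hfix; lra).
  assert (s = 1) by nra. rewrite Hb by lra. nra.
Qed.

Definition conjugates (H : (R -> R) -> Prop) (g : R -> R) (k : R -> R) : Prop :=
  exists h, H h /\ k = conj h g.

Lemma finite_set_no_injection {T : Type} (P : T -> Prop) (s : nat -> T) :
  finite_set P -> (forall n, P (s n)) -> ~ Injective s.
Proof.
  intros [l Hl] HP Hs.
  assert (ND : NoDup (map s (seq 0 (S (length l))))).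
  { apply Injective_map_NoDup; [assumption|apply seq_NoDup]. }
  assert (I : incl (map s (seq 0 (S (length l)))) l).
  { intros t Ht. apply in_map_iff in Ht. destruct Ht as [n [<- _]]. apply Hl, HP. }
  pose proof (NoDup_incl_length ND I). rewrite length_map, length_seq in *. lia.
Qed.

Lemma conjugates_infinite_of_family d H g (f : R -> R -> R) eps : (2 <= d)%nat -> 0 < eps ->
  (forall a, dadic d a -> 0 < a < eps -> H (f a)) ->
  (forall a b, 0 < a < eps -> 0 < b < eps -> conj (f a) g = conj (f b) g -> a = b) ->
  ~ finite_set (conjugates H g).
Proof.
  intros hd heps HH Hinj Hfin.
  destruct (dadic_small_injective_seq d eps hd heps) as [s [Hs hs]].
  apply (finite_set_no_injection _ (fun n => conj (f (s n)) g) Hfin).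
  - intros n. exists (f (s n)). split; [apply HH; apply hs|reflexivity].
  - intros n m E. apply Hs, Hinj; [apply hs|apply hs|assumption].
Qed.

Lemma push_displacement_injective D a b : 2 <= D -> a - a / D = b - b / D -> a = b.
Proof.
  intros HD E.
  assert (/ D < 1) by (rewrite <- Rinv_1; apply Rinv_lt_contravar; lra).
  assert (E' : (a - b) * (1 - / D) = 0) by (unfold Rdiv in E; lra).
  apply Rmult_integral in E'. lra.
Qed.

Lemma conjugates_infinite_target d H g u w x : (2 <= d)%nat ->
  (forall a, dadic d a -> push_admissible (INR d) u w a -> H (push (INR d) u w a)) ->
  u < g x < w -> x < u \/ w <= x -> ~ finite_set (conjugates H g).
Proof.
  intros hd HP hgx hx. pose proof (INR_ge_2 d hd).
  destruct (push_window (INR d) u w (g x)) as [eps [heps Hwin]]; [assumption..|].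
  apply (conjugates_infinite_of_family d H g (push (INR d) u w) eps hd heps).
  - intros a da ha. apply HP; [assumption|apply Hwin, ha].
  - intros a b ha hb E. apply (f_equal (fun k => k x)) in E.
    destruct (Hwin a ha) as [adma wa]. destruct (Hwin b hb) as [admb wb].
    pose proof (push_shift_bounds _ _ _ _ adma). pose proof (push_shift_bounds _ _ _ _ admb).
    rewrite !conj_push, !push_outside, !push_inv_middle in E by (assumption || lra).
    apply (push_displacement_injective (INR d)); lra.
Qed.

Lemma conjugates_infinite_source d H g u w x : (2 <= d)%nat -> Injective g ->
  (forall a, dadic d a -> push_admissible (INR d) u w a -> H (push (INR d) u w a)) ->
  u < x < w -> g x < u \/ w <= g x -> ~ finite_set (conjugates H g).
Proof.
  intros hd Hg HP hx hgx. pose proof (INR_ge_2 d hd).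
  destruct (push_window (INR d) u w x) as [eps [heps Hwin]]; [assumption..|].
  assert (key : forall c, 0 < c < eps ->
    conj (push (INR d) u w c) g (x + c - c / INR d) = g x).
  { intros c hc. destruct (Hwin c hc) as [adm wc].
    pose proof (push_shift_bounds _ _ _ _ adm).
    rewrite conj_push, push_middle by (assumption || lra).
    replace (x + c - c / INR d - c + c / INR d) with x by ring.
    apply push_inv_outside; assumption. }
  apply (conjugates_infinite_of_family d H g (push (INR d) u w) eps hd heps).
  - intros a da ha. apply HP; [assumption|apply Hwin, ha].
  - intros a b ha hb E. destruct (Hwin b hb) as [admb _].
    assert (conj_inj : Injective (conj (push (INR d) u w b) g)).
    { intros y z E'. rewrite !conj_push in E' by exact admb.
      apply (push_injective _ _ _ _ admb), Hg, (push_inv_injective _ _ _ _ admb), E'. }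
    apply (push_displacement_injective (INR d)); [assumption|].
    enough (x + a - a / INR d = x + b - b / INR d) by lra.
    apply conj_inj. rewrite (key b hb), <- (key a ha), E. reflexivity.
Qed.

Lemma fixes_on_of_finite_conjugates d H g p q : (2 <= d)%nat -> 0 <= p < q -> q <= 1 ->
  contains_pushes d H p q -> Vd d g -> finite_set (conjugates H g) -> fixes_on p q g.
Proof.
  intros hd hpq hq HP Hg Hfin. apply (fixes_on_of_interior d); [assumption..|].
  intros x hx. apply NNPP. intros hne.
  destruct (classic (p < g x < q)) as [hy|hy].
  - destruct (Rlt_or_le x (g x)) as [hlt|hle].
    + destruct (dadic_dense d x (g x) hd hlt) as [u [du hu]].
      destruct (dadic_dense d (g x) q hd) as [w [dw hw]]; [lra|].
      apply (conjugates_infinite_target d H g u w x hd (HP u w du dw ltac:(lra) ltac:(lra)));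
        [lra|lra|assumption].
    + destruct (dadic_dense d p (g x) hd) as [u [du hu]]; [lra|].
      destruct (dadic_dense d (g x) x hd) as [w [dw hw]]; [lra|].
      apply (conjugates_infinite_target d H g u w x hd (HP u w du dw ltac:(lra) ltac:(lra)));
        [lra|lra|assumption].
  - destruct (dadic_dense d p x hd) as [u [du hu]]; [lra|].
    destruct (dadic_dense d x q hd) as [w [dw hw]]; [lra|].
    apply (conjugates_infinite_source d H g u w x hd (Vd_injective d g Hg)
      (HP u w du dw ltac:(lra) ltac:(lra))); [lra| |assumption].
    destruct (Rlt_or_le (g x) u); [left; assumption|right].
    apply Rnot_lt_le. intros hlt. apply hy. lra.
Qed.

Lemma Vd_fixes_off_left d f c : Vd d f -> fixes_on c 1 f ->
  forall x, ~ (0 <= x < c) -> f x = x.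
Proof.
  intros Hf Ff x hx. destruct (Rle_or_lt c x) as [hcx|hxc].
  - destruct (Rlt_or_le x 1); [apply Ff; lra|].
    apply (proj1 Hf). intros [_ hx1]. lra.
  - apply (proj1 Hf). intros hx01. apply hx. unfold inI in hx01. lra.
Qed.

Lemma centralizer_eq_stabilizer d G H p q : (2 <= d)%nat -> 0 <= p < q -> q <= 1 ->
  (forall g, G g -> Vd d g) -> contains_pushes d H p q ->
  (forall g h, G g -> fixes_on p q g -> H h -> conj h g = g) ->
  same_set (vcentralizer G H) (centralizer G H) /\
  same_set (centralizer G H) (fun g => G g /\ fixes_on p q g).
Proof.
  intros hd hpq hq GV HP Hcomm.
  assert (VC_fixes : forall g, vcentralizer G H g -> G g /\ fixes_on p q g).
  { intros g [Gg Hfin]. split; [assumption|].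
    apply (fixes_on_of_finite_conjugates d H); auto. }
  assert (C_VC : forall g, centralizer G H g -> vcentralizer G H g).
  { intros g [Gg Hg]. split; [assumption|]. exists (g :: nil).
    intros k [h [Hh ->]]. rewrite Hg by assumption. left. reflexivity. }
  assert (fixes_C : forall g, G g /\ fixes_on p q g -> centralizer G H g).
  { intros g [Gg Fg]. split; [assumption|]. intros h Hh. apply Hcomm; assumption. }
  split; intros g; split; auto.
Qed.

Lemma centralizers_of_cut d G c : (2 <= d)%nat -> 0 < c < 1 ->
  (forall g, G g -> Vd d g) -> contains_pushes d G 0 1 ->
  (same_set (vcentralizer G (fun f => G f /\ fixes_on 0 c f))
            (centralizer G (fun f => G f /\ fixes_on 0 c f)) /\
   same_set (centralizer G (fun f => G f /\ fixes_on 0 c f))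
            (fun f => G f /\ fixes_on c 1 f)) /\
  (same_set (vcentralizer G (fun f => G f /\ fixes_on c 1 f))
            (centralizer G (fun f => G f /\ fixes_on c 1 f)) /\
   same_set (centralizer G (fun f => G f /\ fixes_on c 1 f))
            (fun f => G f /\ fixes_on 0 c f)).
Proof.
  intros hd hc GV HG. split.
  - apply (centralizer_eq_stabilizer d G _ c 1 hd); [lra|lra|assumption| |].
    + apply contains_pushes_fixing; [assumption|lra|lra|lra].
    + intros g h Gg Fg [Gh Fh]. apply conj_of_commute; [apply (Vd_injective d), GV, Gh|].
      apply (commute_of_disjoint_supports (fun x => 0 <= x < c));
        [apply (Vd_injective d), GV, Gg|apply (Vd_injective d), GV, Gh| |exact Fh].
      apply (Vd_fixes_off_left d); auto.
  - apply (centralizer_eq_stabilizer d G _ 0 c hd); [lra|lra|assumption| |].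
    + apply contains_pushes_fixing; [assumption|lra|lra|lra].
    + intros g h Gg Fg [Gh Fh]. apply conj_of_commute; [apply (Vd_injective d), GV, Gh|].
      intros x. symmetry.
      apply (commute_of_disjoint_supports (fun x => 0 <= x < c));
        [apply (Vd_injective d), GV, Gh|apply (Vd_injective d), GV, Gg| |exact Fg].
      apply (Vd_fixes_off_left d); auto.
Qed.

Theorem lemma5p9 (d : nat) (hd : (2 <= d)%nat) :
  (same_set (vcentralizer (Vd d) (V_left d)) (centralizer (Vd d) (V_left d)) /\
   same_set (centralizer (Vd d) (V_left d)) (V_right d)) /\
  (same_set (vcentralizer (Vd d) (V_right d)) (centralizer (Vd d) (V_right d)) /\
   same_set (centralizer (Vd d) (V_right d)) (V_left d)) /\
  (same_set (vcentralizer (Td d) (T_left d)) (centralizer (Td d) (T_left d)) /\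
   same_set (centralizer (Td d) (T_left d)) (T_right d)) /\
  (same_set (vcentralizer (Td d) (T_right d)) (centralizer (Td d) (T_right d)) /\
   same_set (centralizer (Td d) (T_right d)) (T_left d)).
Proof.
  assert (hc : 0 < 1 / INR d < 1).
  { pose proof (INR_ge_2 d hd). split; [apply Rdiv_lt_0_compat; lra|].
    apply (Rmult_lt_reg_r (INR d)); [lra|]. field_simplify; lra. }
  destruct (centralizers_of_cut d (Vd d) (1 / INR d) hd hc)
    as [V_left_case V_right_case]; [auto|apply contains_pushes_Vd, hd|].
  destruct (centralizers_of_cut d (Td d) (1 / INR d) hd hc)
    as [T_left_case T_right_case]; [intros g [Vg _]; exact Vg|apply contains_pushes_Td, hd|].
  split; [|split; [|split]]; assumption.
Qed.
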